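(* It is a theorem of $\mathsf{ZFC}$ that the Hausdorff dimensions of Hamel bases range over $[0,1]$; that is, for every $s\in[0,1]$ there is a Hamel basis $H\subseteq\mathbb{R}$ whose Hausdorff dimension is $s$.
   Context: A Hamel basis is a subset of $\mathbb{R}$ that is a basis of $\mathbb{R}$ as a vector space over $\mathbb{Q}$. Hausdorff dimension is with respect to the usual metric on $\mathbb{R}$. *)

(* Defs.v *)
From mathcomp Require Import all_boot all_order all_algebra.
From mathcomp Require Import all_classical all_reals all_analysis.

Set Implicit Arguments.
Unset Strict Implicit.
Unset Printing Implicit Defensive.

Import Order.TTheory GRing.Theory Num.Theory.

Local Open Scope classical_set_scope.
Local Open Scope ring_scope.

Section HamelBasis.
Context {R : realType}.
Implicit Types H : set R.

(* A finite rational combination is given by its support, a duplicate-free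
   sequence, and by a coefficient function of which only the values on that
   sequence matter. *)
Definition Qlinear_independent H : Prop :=
  forall (h : seq R) (c : R -> rat),
    uniq h -> [set` h] `<=` H -> \sum_(x <- h) ratr (c x) * x = 0 ->
    forall x, x \in h -> c x = 0.

Definition Qspanning H : Prop :=
  forall y : R, exists (h : seq R) (c : R -> rat),
    [/\ uniq h, [set` h] `<=` H & y = \sum_(x <- h) ratr (c x) * x].

Definition hamel_basis H : Prop := Qlinear_independent H /\ Qspanning H.

End HamelBasis.

Section HausdorffDimension.
Context {R : realType}.
Implicit Types (A : set R) (s delta : R).
Local Open Scope ereal_scope.

(* Adjoining 0 gives the empty set diameter 0, the supremum of the empty set
   being -oo in \bar R; it changes nothing for a nonempty set. *)
Definition diameter A : \bar R :=
  ereal_sup (0 |` [set `|x.1 - x.2|%:E | x in A `*` A]).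

(* diam(A)^s with the usual conventions at s = 0: 0^0 = 1 for a nonempty set
   (this is poweR at exponent 0), while the empty set contributes 0. *)
Definition diameter_pow s A : \bar R :=
  if A == set0 then 0 else poweR (diameter A) s.

(* Countable covers are sequences of arbitrary subsets of R; finite covers are
   included since members may be empty. *)
Definition hausdorff_premeasure s delta A : \bar R :=
  ereal_inf [set \sum_(0 <= i <oo) diameter_pow s (U i) |
    U in [set U : (set R)^nat |
      (forall i, diameter (U i) <= delta%:E) /\ A `<=` \bigcup_i U i]].

(* The supremum over delta > 0 is the limit as delta tends to 0 from above,
   since hausdorff_premeasure is nonincreasing in delta. *)
Definition hausdorff_measure s A : \bar R :=
  ereal_sup [set hausdorff_premeasure s delta A |
    delta in [set delta : R | (0 < delta)%R]].

Definition hausdorff_dim A : \bar R :=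
  ereal_inf [set s%:E |
    s in [set s : R | (0 <= s)%R /\ hausdorff_measure s A = 0]].

End HausdorffDimension.

(* Main.v *)
Require Import Defs.
From mathcomp Require Import all_boot all_order all_algebra.
From mathcomp Require Import all_classical all_reals all_analysis.
From mathcomp Require Import zify ring lra.

(** The basis is squeezed between two sets. On one side, there is a set [A] of
Hausdorff dimension 0 with [A + A] the whole line; on the other, a linearly
independent set [B] of Hausdorff dimension [s]. By Zorn's lemma [B] extends to
a Hamel basis [H] with [B <= H <= B U A] (lemma [hamel_extension]), and then
[dim H = max (s, 0) = s].

The set [A] is the intersection over [k] of open sets, the [k]-th of which
surrounds each rational by an interval so small that the [t]-th powers of the
lengths have a small sum as soon as [k] is large compared to [1 / t]. This is a
dense G_delta, so by Baire's theorem it meets each of its reflections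
[y - A], which is [A + A = R].

The set [B] is the image of [[0, 1)] under an injection [code]. The binary
expansion of [code x] consists, for each [n], of a block of fresh binary
digits of [x], followed by a long block of zeros containing a single 1. The
digits already written form an integer [digits n x], and the 1 is placed at
distance [n.+1 * (digits n x).+1] from the start of its block.

- Independence comes from the isolated ones. Given finitely many distinct [x],
  take [n] so large that the integers [digits n x] are distinct, and multiply
  by the power of two that brings the isolated 1 of a chosen [x0] to depth
  [n.+1] behind the binary point. Modulo 1 the value at [x0] becomes about
  [ep = 2 ^- n.+1], whereas the others become [O(ep ^+ 2)], their own isolated
  ones having gone either into the integral part or at least [n.+1] places
  further. An integral relation with bounded coefficients would make the
  coefficient of [x0], times [ep], almost an integer without being one.

- The dimension comes from counting the digits of [x] among those of [code x].
  If [free n] digits of [x] are written among the first [pos n] digits of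
  [code x], then [B] is covered by [2 ^ free n] pieces of diameter [2 ^- pos n].
  As [free n <= s * pos n], this bounds the dimension by [s]. Conversely
  [free n >= t * pos n - K] for each [t < s], and this makes the inverse of
  [code] Hoelder continuous with exponent [t]. As the inverse maps [B] onto
  [[0, 1)], which has positive Lebesgue measure, the [t]-dimensional measure of
  [B] cannot vanish. The code blocks do not spoil the count because the numbers
  [free n] grow like a tower of exponentials: the block coding [free n] digits
  has length about [n.+1 * 2 ^ free n], which is negligible before [free n.+1]. *)

Import Order.TTheory GRing.Theory Num.Theory.
Import numFieldNormedType.Exports.
Local Open Scope classical_set_scope.
Local Open Scope ring_scope.

(** * Hamel bases between an independent set and a generating set *)

Section HamelExtension.
Context {R : realType}.
Implicit Types (H B S : set R) (y : R).

(** Separate from [Qspanning], because spans are built up one vector at a time. *)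
Definition Qspan H y : Prop := exists (h : seq R) (c : R -> rat),
  [/\ uniq h, [set` h] `<=` H & y = \sum_(x <- h) ratr (c x) * x].

(** Combinations supported by different sequences can only be added after both
are rewritten over a common support. *)
Lemma sum_sub_support (h h' : seq R) (F : R -> R) :
  uniq h -> uniq h' -> {subset h <= h'} ->
  (forall x, x \in h' -> x \notin h -> F x = 0) ->
  \sum_(x <- h') F x = \sum_(x <- h) F x.
Proof.
move=> uh uh' hh' F0.
rewrite (bigID (mem h)) /= addrC big1_seq ?add0r; last first.
  by move=> x /andP[xh xh']; exact: F0.
rewrite -big_filter; apply/perm_big/uniq_perm => //; first exact: filter_uniq.
move=> x; rewrite mem_filter andb_idr //; exact: hh'.
Qed.

Lemma Qspan_mem {H x} : H x -> Qspan H x.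
Proof.
move=> Hx; exists [:: x], (fun=> 1); split => //.
- by move=> z /=; rewrite inE => /eqP ->.
- by rewrite big_seq1 rmorph1 mul1r.
Qed.

Lemma Qspan_add H y z : Qspan H y -> Qspan H z -> Qspan H (y + z).
Proof.
move=> [h [c [uh hH ->]]] [k [d [uk kH ->]]].
pose e x : rat := (if x \in h then c x else 0) + (if x \in k then d x else 0).
exists (undup (h ++ k)), e; split; first exact: undup_uniq.
  move=> x /=; rewrite mem_undup mem_cat => /orP[]; [exact: hH|exact: kH].
rewrite [RHS](eq_bigr (fun x =>
  ratr (if x \in h then c x else 0) * x + ratr (if x \in k then d x else 0) * x));
  last by move=> x _; rewrite /e rmorphD mulrDl.
rewrite big_split /=; congr +%R.
- rewrite [RHS](@sum_sub_support h) ?undup_uniq//.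
  + by rewrite !big_seq; apply: eq_bigr => x ->.
  + by move=> x xh; rewrite mem_undup mem_cat xh.
  + by move=> x _ /negbTE ->; rewrite rmorph0 mul0r.
- rewrite [RHS](@sum_sub_support k) ?undup_uniq//.
  + by rewrite !big_seq; apply: eq_bigr => x ->.
  + by move=> x xh; rewrite mem_undup mem_cat xh orbT.
  + by move=> x _ /negbTE ->; rewrite rmorph0 mul0r.
Qed.

(** In a nontrivial relation the coefficient of [a] cannot vanish, the rest
being independent; solving for [a] gives the combination. *)
Lemma Qspan_of_dependent H a :
  Qlinear_independent H -> ~ Qlinear_independent (H `|` [set a]) -> Qspan H a.
Proof.
move=> indH /existsNP[h /existsNP[c /not_implyP[uh /not_implyP[hH
  /not_implyP[sum0 /existsNP[x /not_implyP[xh /eqP cx0]]]]]]].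
have remH : [set` rem a h] `<=` H.
  move=> z /=; rewrite mem_rem_uniq// inE => /andP[/eqP za zh].
  by case: (hH z zh) => // /za.
have [ah|ah] := boolP (a \in h); last first.
  have hH' : [set` h] `<=` H.
    move=> z /= zh; case: (hH z zh) => // za; move: ah.
    by rewrite -za /= zh.
  by move: cx0; rewrite (indH h c uh hH' sum0 x xh) eqxx.
move: sum0; rewrite (big_rem a)//= => sum0.
have [ca0|ca0] := eqVneq (c a) 0.
  move: sum0; rewrite ca0 rmorph0 mul0r add0r => sum0.
  have xa : x \in rem a h.
    by rewrite mem_rem_uniq// inE xh andbT; apply: contra_neq cx0 => ->.
  by move: cx0; rewrite (indH _ c (rem_uniq a uh) remH sum0 x xa) eqxx.
exists (rem a h), (fun z => - (c z / c a)); split => //; first exact: rem_uniq.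
have ca0' : ratr (c a) != 0 :> R by rewrite fmorph_eq0.
apply: (mulfI ca0'); move/eqP: sum0; rewrite addr_eq0 => /eqP ->.
rewrite -sumrN mulr_sumr; apply: eq_bigr => z _.
rewrite rmorphN /= fmorph_div /= mulrA mulrN mulNr; congr (- (_ * _)).
by rewrite mulrCA divff ?mulr1.
Qed.

(** Independence has finite character; this is the step that carries it to the
union of a chain. The first alternative covers the empty chain. *)
Lemma chain_cover_seq {F : set (set R)} {h : seq R} {B} :
  total_on F subset -> [set` h] `<=` \bigcup_(X in F) X `|` B ->
  [set` h] `<=` B \/ exists2 X, F X & [set` h] `<=` X `|` B.
Proof.
move=> totF; elim: h => [|x h IH] hF; first by left.
have [|hB|[X FX hX]] := IH.
- by move=> z zh; apply: hF; rewrite /= inE zh orbT.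
- have [[X FX Xx]|Bx] := hF x (mem_head _ _).
    right; exists X => // z /=; rewrite inE => /orP[/eqP ->|/hB]; by [left|right].
  by left => z /=; rewrite inE => /orP[/eqP ->|/hB].
- right; have [[Y FY Yx]|Bx] := hF x (mem_head _ _); last first.
    exists X => // z /=; rewrite inE => /orP[/eqP ->|/hX//]; by right.
  have [XY|YX] := totF X Y FX FY.
    exists Y => // z /=; rewrite inE => /orP[/eqP ->|/hX [/XY|]]; by [left|right].
  exists X => // z /=; rewrite inE => /orP[/eqP ->|/hX//]; left; exact: YX.
Qed.

(** A maximal [X <= S] with [X U B] independent exists by Zorn's lemma. Every
element of [S] is then in the span of [X U B], hence so is every sum of two
elements of [S]. *)
Lemma hamel_extension B S : Qlinear_independent B ->
  (forall y, exists a b, [/\ S a, S b & y = a + b]) ->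
  exists H, [/\ hamel_basis H, B `<=` H & H `<=` B `|` S].
Proof.
move=> indB SS.
(* B is kept outside X so that the property also holds of the empty union *)
pose P X := Qlinear_independent (X `|` B) /\ X `<=` S.
have [F FP totF|X [[indX XS] maxX]] := @Zorn_bigcup R P.
  split; last by move=> x [X /FP[_]]; exact.
  move=> h c uh /(chain_cover_seq totF)[hB|[X /FP[indX _] hX]].
    exact: (indB h c uh hB).
  exact: indX h c uh hX.
exists (X `|` B); split; last 2 first.
- by move=> x; right.
- by move=> x [/XS|]; [right|left].
split => // y; have [a [b [Sa Sb ->]]] := SS y.
suff span c : S c -> Qspan (X `|` B) c by apply: Qspan_add; exact: span.
move=> Sc; have [Xc|Xc] := pselect (X c); first by apply: Qspan_mem; left.
apply: Qspan_of_dependent => // ind; apply: (maxX (X `|` [set c])); last first.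
  split; last by move=> z [/XS//|->].
  by rewrite setUAC.
by split; [move=> z; left|move=> /(_ c) /(_ (or_intror erefl))].
Qed.

End HamelExtension.

(** * Powers of two *)

Section PowersOfTwo.
Context {R : realType}.
Implicit Types (t e : R) (m n : nat).

Lemma half_pow_le m n : (m <= n)%N -> 2 ^- n <= 2 ^- m :> R.
Proof. by move=> mn; rewrite lef_pV2 ?posrE ?exprn_gt0// ler_weXn2l ?ler1n. Qed.

Lemma half_pow_le_of_inv n e : 0 < e -> e^-1 <= n.+1%:R -> 2 ^- n <= e.
Proof.
move=> e0 en; rewrite -[leRHS]invrK lef_pV2 ?posrE ?exprn_gt0 ?invr_gt0//.
by apply: (le_trans en); rewrite -natrX ler_nat ltn_expl.
Qed.

(** Estimates at a real exponent [t] are thereby reduced to the comparison of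
exponents of 2. *)
Lemma powR_half_le m n t : n%:R <= m%:R * t -> (2 ^- m) `^ t <= (2 ^- n : R).
Proof.
move=> mn; rewrite -!powR_invn// -powRrM.
rewrite mulNr; apply: ler_powR; first by rewrite ler1n.
by rewrite lerN2.
Qed.

Lemma int_pow2 n : (2 ^+ n : R) \is a Num.int.
Proof. by rewrite rpredX// rpred_nat. Qed.

Lemma pow2_div_int m n : (m <= n)%N -> 2 ^+ n * 2 ^- m = 2 ^+ (n - m) :> R.
Proof.
by move=> mn; rewrite -{1}(subnK mn) exprD mulfK// expf_neq0// pnatr_eq0.
Qed.

Lemma pow2_div_le a b p : (a + b <= p)%N -> 2 ^+ a * 2 ^- p <= 2 ^- b :> R.
Proof.
move=> abp; have p0 : 0 < 2 ^+ a :> R by rewrite exprn_gt0.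
rewrite -ler_pdivlMl// -invfM -exprD; exact: half_pow_le.
Qed.

End PowersOfTwo.

(** * Upper bounds on Hausdorff measure *)

Section HausdorffNull.
Context {R : realType}.
Implicit Types (A B : set R) (s t e r : R).
Local Open Scope ereal_scope.

Lemma diameter_ge0 A : 0 <= diameter A.
Proof. by apply: ereal_sup_ubound; left. Qed.

Lemma diameter_le A r : (0 <= r)%R ->
  (forall x y, A x -> A y -> (`|x - y| <= r)%R) -> diameter A <= r%:E.
Proof.
move=> r0 Ar; apply: ge_ereal_sup => _ [->|[[x y] [/= Ax Ay] <-]].
  by rewrite lee_fin.
by rewrite lee_fin Ar.
Qed.

Lemma le_diameter A x y : A x -> A y -> `|x - y|%:E <= diameter A.
Proof. by move=> Ax Ay; apply: ereal_sup_ubound; right; exists (x, y). Qed.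

Lemma diameter_pow_ge0 t A : 0 <= diameter_pow t A.
Proof. by rewrite /diameter_pow; case: ifP => // _; exact: poweR_ge0. Qed.

Lemma diameter_pow_le t A r : (0 <= t)%R -> (0 <= r)%R ->
  (forall x y, A x -> A y -> (`|x - y| <= r)%R) ->
  diameter_pow t A <= (r `^ t)%:E.
Proof.
move=> t0 r0 Ar; rewrite /diameter_pow; case: ifP => _.
  by rewrite lee_fin powR_ge0.
rewrite -poweR_EFin; apply: gt0_ler_poweR => //.
- by rewrite in_itv /= diameter_ge0 leey.
- by rewrite in_itv /= lee_fin r0 leey.
- exact: diameter_le.
Qed.

(** A single bound [e] controls both the mesh and the sum, so that nullity of
the measure no longer involves a supremum of infima. *)
Definition finely_covered t A := forall e, (0 < e)%R ->
  exists U : (set R)^nat, [/\ forall i, diameter (U i) <= e%:E,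
    A `<=` \bigcup_i U i & \sum_(0 <= i <oo) diameter_pow t (U i) <= e%:E].

Lemma finely_covered_null t A : finely_covered t A -> hausdorff_measure t A = 0.
Proof.
move=> covA; apply/eqP; rewrite eq_le; apply/andP; split.
  apply: ge_ereal_sup => _ [d d0 <-].
  apply/lee_addgt0Pr => e e0; rewrite add0e.
  have me0 : (0 < Num.min d e)%R by rewrite lt_min d0.
  have [U [dU AU sU]] := covA _ me0.
  apply: (@le_trans _ _ (\sum_(0 <= i <oo) diameter_pow t (U i))).
    apply: ereal_inf_lbound; exists U => //; split => // i.
    by apply: (le_trans (dU i)); rewrite lee_fin ge_min lexx.
  by apply: (le_trans sU); rewrite lee_fin ge_min lexx orbT.
apply: (@le_trans _ _ (hausdorff_premeasure t 1 A)).
  apply: le_ereal_inf_tmp => _ [U _ <-].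
  by apply: nneseries_ge0 => i _ _; exact: diameter_pow_ge0.
by apply: ereal_sup_ubound; exists 1%R => //=.
Qed.

Lemma finely_covered_sub t A B : A `<=` B -> finely_covered t B ->
  finely_covered t A.
Proof.
move=> AB covB e /covB[U [dU BU sU]]; exists U; split => //.
exact: subset_trans BU.
Qed.

(** A partial sum of [n] terms is at most that of [2n] terms, in which the two
series are paired term by term. *)
Lemma interleave_series (u v : (\bar R)^nat) :
  (forall i, 0 <= u i) -> (forall i, 0 <= v i) ->
  \sum_(0 <= i <oo) (if odd i then v i./2 else u i./2)
    <= \sum_(0 <= i <oo) u i + \sum_(0 <= i <oo) v i.
Proof.
move=> u0 v0; set w := fun i => if odd i then v i./2 else u i./2.
have w0 i : 0 <= w i by rewrite /w; case: ifP.
apply: lime_le; first by apply: is_cvg_nneseries => i _ _; exact: w0.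
apply: nearW => n; rewrite -nneseriesD//.
have E m : \sum_(0 <= i < m.*2) w i = \sum_(0 <= i < m) (u i + v i).
  elim: m => [|m IH]; first by rewrite !big_nil.
  rewrite doubleS 2?big_nat_recr //= [in RHS]big_nat_recr //= IH -addeA.
  rewrite /w /= odd_double /=.
  by rewrite doubleK uphalf_double.
apply: (@le_trans _ _ (\sum_(0 <= i < n.*2) w i)).
  by apply: lee_sum_nneg_natr => [i _ _|]; [exact: w0|rewrite -addnn leq_addr].
by rewrite E; apply: nneseries_lim_ge => i _; rewrite adde_ge0.
Qed.

Lemma finely_covered_setU t A B :
  finely_covered t A -> finely_covered t B -> finely_covered t (A `|` B).
Proof.
move=> covA covB e e0; have e20 : (0 < e / 2)%R by rewrite divr_gt0.
have [U [dU AU sU]] := covA _ e20; have [V [dV BV sV]] := covB _ e20.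
have e2e : (e / 2)%:E <= e%:E by rewrite lee_fin; lra.
exists (fun i => if odd i then V i./2 else U i./2); split.
- by move=> i; case: ifP => _; [apply: le_trans (dV _) _|apply: le_trans (dU _) _].
- move=> x [/AU|/BV] [i _ xi].
    by exists i.*2 => //; rewrite odd_double doubleK.
  by exists i.*2.+1 => //=; rewrite odd_double /= uphalf_double.
- have -> : e%:E = (e / 2)%:E + (e / 2)%:E by rewrite -EFinD; congr EFin; field.
  apply: le_trans (leeD sU sV); apply: le_trans (interleave_series _ _ _ _).
  + apply: lee_nneseries => [i _ _|i _]; first exact: diameter_pow_ge0.
    by case: ifP.
  + by move=> i; exact: diameter_pow_ge0.
  + by move=> i; exact: diameter_pow_ge0.
Qed.

End HausdorffNull.

(** * A null dense G_delta set whose sumset is the line *)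

Section NullDenseGdelta.
Context {R : realType}.
Implicit Types (t e : R).

(** The interval around the [j]-th rational has length
[2 ^- (k.+1 * (j + k.+1))]: the factor [k.+1] beats any fixed exponent [t > 0],
and the factor [j + k.+1] makes the sum over [j] at most [2 ^- k]. The default
value 0 stands for the indices [j] that enumerate no rational. *)
Definition rational_nbhd k : set R := \bigcup_j
  ball (ratr (odflt 0 (unpickle j : option rat)) : R) (2 ^- (k.+1 * (j + k.+1)).+1).

Lemma open_rational_nbhd k : open (rational_nbhd k).
Proof. by apply: bigcup_open => j _; apply: ball_open; rewrite invr_gt0 exprn_gt0. Qed.

Lemma dense_rational_nbhd k : dense (rational_nbhd k).
Proof.
move=> O O0 oO; have [x [Ox [q _ qx]]] := dense_rat O0 oO.
exists x; split => //; exists (pickle q) => //; rewrite pickleK /= qx.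
by apply: ballxx; rewrite invr_gt0 exprn_gt0.
Qed.

Lemma dense_reflection (O : set R) y :
  open O -> dense O -> open ((fun x => y - x) @^-1` O) /\ dense ((fun x => y - x) @^-1` O).
Proof.
move=> oO dO.
have openV V : open V -> open ((fun x : R => y - x) @^-1` V).
  move: V; apply/continuousP => x.
  by apply: cvgB; [exact: cvg_cst|exact: cvg_id].
split; first exact: openV.
move=> V [v Vv] oV; have [||x [Vx Ox]] := dO ((fun x => y - x) @^-1` V) _ _.
- by exists (y - v); rewrite /= subKr.
- exact: openV.
- by exists (y - x); split => //=; rewrite subKr.
Qed.

(** By Baire's theorem the dense G_delta meets its reflection [y - _]. *)
Lemma null_dense_Gdelta_sum y : exists a b : R,
  [/\ (\bigcap_k rational_nbhd k) a, (\bigcap_k rational_nbhd k) b & y = a + b].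
Proof.
(* the even terms are the open sets, the odd ones their reflections *)
pose F i := if odd i then (fun x => y - x) @^-1` rational_nbhd i./2
            else rational_nbhd i./2.
have odF i : open (F i) /\ dense (F i).
  rewrite /F; case: ifP => _; last first.
    split; [exact: open_rational_nbhd|exact: dense_rational_nbhd].
  apply: dense_reflection;[exact: open_rational_nbhd|exact: dense_rational_nbhd].
have [||a [_ Fa]] := @Baire R R^o F odF setT _ _.
- by exists 0.
- exact: openT.
exists a, (y - a); split.
- by move=> k _; have := Fa k.*2 I; rewrite /F odd_double doubleK.
- by move=> k _; have := Fa k.*2.+1 I; rewrite /F /= odd_double /= uphalf_double.
- by rewrite subrKC.
Qed.

Lemma finely_covered_null_Gdelta t : 0 < t ->
  finely_covered t (\bigcap_k rational_nbhd k).
Proof.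
move=> t0 e e0.
have [k kt ke] : exists2 k, 1 <= k.+1%:R * t & 2 ^- k <= e.
  exists (Num.truncn (t^-1 + e^-1)); set k := Num.truncn _.
    rewrite -ler_pdivrMr// div1r; apply/ltW.
    by apply: le_lt_trans (truncnS_gt _); rewrite lerDl invr_ge0 ltW.
  apply: half_pow_le_of_inv => //.
  apply/ltW; apply: le_lt_trans (truncnS_gt _).
  by rewrite lerDr invr_ge0 ltW.
exists (fun j => ball (ratr (odflt 0 (unpickle j : option rat)) : R)
                   (2 ^- (k.+1 * (j + k.+1)).+1)).
have dist j x y : ball (ratr (odflt 0 (unpickle j : option rat)) : R)
                   (2 ^- (k.+1 * (j + k.+1)).+1) x ->
  ball (ratr (odflt 0 (unpickle j : option rat)) : R)
                   (2 ^- (k.+1 * (j + k.+1)).+1) y ->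
  `|x - y| <= 2 ^- (k.+1 * (j + k.+1)).
  rewrite -!ball_normE /= => qx qy.
  set q := ratr _ in qx qy; set m := (k.+1 * _)%N in qx qy *.
  have E : 2 ^- m.+1 = 2 ^- m / 2 :> R by rewrite exprSr invfM.
  rewrite -(subrKA q) (le_trans (ler_normD _ _))// (distrC x).
  by move: qx qy; rewrite E; lra.
split.
- move=> j; apply: diameter_le => [|x y /dist h /h]; first exact: ltW.
  move=> /le_trans; apply; apply: le_trans ke.
  rewrite lef_pV2 ?posrE ?exprn_gt0// ler_weXn2l ?ler1n//.
  by nia.
- by move=> x /(_ k I).
- apply: (@le_trans _ _ (2 ^- k)%:E); last by rewrite lee_fin.
  rewrite -div1r; have /cvg_lim <- // := @cvg_geometric_eseries_half R 1 k.
  apply: lee_nneseries => [j _ _|j _]; first exact: diameter_pow_ge0.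
  have r0 : 0 <= 2 ^- (k.+1 * (j + k.+1)) :> R by rewrite invr_ge0 exprn_ge0.
  apply: le_trans (diameter_pow_le _ _ _ (ltW t0) r0 (dist j)) _.
  rewrite lee_fin natrX div1r; apply: powR_half_le.
  rewrite mulnC natrM -mulrA; apply: ler_peMr => //; lra.
Qed.

End NullDenseGdelta.

(** * The mass distribution principle *)

Section MassDistribution.
Context {R : realType}.
Implicit Types (f : R -> R) (A : set R) (t C : R).
Local Open Scope ereal_scope.

(** The part of [[0, 1)] sent into [U] has diameter at most
[C * diameter U ^ t], hence lies in an interval of twice that length. Such an
interval is measurable, which the preimage need not be. *)
Lemma expanding_preimage_itv {t f C} (U : set R) : (0 <= t)%R -> (0 < C)%R ->
  {in `[0%R, 1%R[ &, forall x y, (`|x - y| <= C * `|f x - f y| `^ t)%R} ->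
  diameter U < +oo ->
  exists I : set R, [/\ measurable I,
    forall x, x \in `[0%R, 1%R[ -> U (f x) -> I x &
    lebesgue_measure I <= (2 * C)%:E * diameter_pow t U].
Proof.
move=> t0 C0 fC dU.
have [[x0 [x01 Ux0]]|noU] :=
    pselect (exists x0, x0 \in `[0%R, 1%R[%R /\ U (f x0)); last first.
  exists set0; split => //; first by move=> x xI Ux; apply: noU; exists x.
  by rewrite measure0 mule_ge0 ?diameter_pow_ge0// lee_fin; lra.
have dfin : diameter U \is a fin_num by rewrite ge0_fin_numE ?diameter_ge0.
set l := (C * fine (diameter U) `^ t)%R.
have l0 : (0 <= l)%R by rewrite mulr_ge0 ?powR_ge0// ltW.
exists `[(x0 - l)%R, (x0 + l)%R]%classic; split => //.
- move=> x xI Ux.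
  have /le_trans h := fC x x0 xI x01.
  have : (`|x - x0| <= l)%R.
    apply: h; rewrite ler_pM2l//; apply: ge0_ler_powR => //.
    + by rewrite nnegrE fine_ge0 ?diameter_ge0.
    + by rewrite -lee_fin fineK//; exact: le_diameter.
  by rewrite ler_distl /= in_itv.
- rewrite lebesgue_measure_itv /= lte_fin.
  have /negbTE U0 : U != set0 by apply/set0P; exists (f x0).
  rewrite /diameter_pow U0.
  rewrite -(fineK dfin) poweR_EFin -EFinM; case: ifP => _.
    by rewrite -EFinB lee_fin /l; lra.
  by rewrite lee_fin; move: l0; rewrite /l; lra.
Qed.

(** Mass distribution principle: a cover of [A] of small [t]-dimensional size
would pull back to a cover of [[0, 1)] by intervals of total length less
than 1. *)
Lemma hausdorff_measure_expanding t f C A : (0 <= t)%R -> (0 < C)%R ->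
  {in `[0%R, 1%R[ &, forall x y, (`|x - y| <= C * `|f x - f y| `^ t)%R} ->
  (forall x, x \in `[0%R, 1%R[ -> A (f x)) ->
  hausdorff_measure t A != 0.
Proof.
move=> t0 C0 fC fA; apply/eqP => H0.
have : hausdorff_premeasure t 1 A < (2 * C)^-1%:E.
  apply: (@le_lt_trans _ _ 0); last by rewrite lte_fin invr_gt0; lra.
  by rewrite -H0; apply: ereal_sup_ubound; exists 1%R => //=.
move=> /ereal_inf_lt[_ [U [dU AU] <-]] sU.
have dUy i : diameter (U i) < +oo by apply: le_lt_trans (dU i) (ltry _).
pose I i := projT1 (cid (expanding_preimage_itv (U i) t0 C0 fC (dUy i))).
have IP i : [/\ measurable (I i),
    forall x, x \in `[0%R, 1%R[%R -> U i (f x) -> I i x &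
    lebesgue_measure (I i) <= (2 * C)%:E * diameter_pow t (U i)].
  by rewrite /I; case: cid.
have : lebesgue_measure (`[0%R, 1%R[%classic : set R) <=
    \sum_(0 <= i <oo) lebesgue_measure (I i).
  apply: measure_sigma_subadditive => //.
  - by move=> i; case: (IP i).
  - move=> x /= x01; have [i _ Ui] := AU _ (fA x x01).
    by exists i => //; have [_ + _] := IP i; exact.
rewrite lebesgue_measure_itv /= lte01 -EFinB subr0 leNgt => /negP; apply.
apply: (@le_lt_trans _ _ (\sum_(0 <= i <oo) (2 * C)%:E * diameter_pow t (U i))).
  by apply: lee_nneseries => // i _; case: (IP i).
rewrite nneseriesZl; last by move=> i _; exact: diameter_pow_ge0.
have C20 : (0 < 2 * C)%R by lra.
by rewrite muleC -lte_pdivlMr// mul1e.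
Qed.

End MassDistribution.

(** * A linearly independent set of prescribed dimension *)

Section Encoding.
Context {R : realType} (s : R) (s01 : 0 < s <= 1).
Implicit Types (x y t e : R) (n : nat).

(** The pair at [n] is [(free n, pos n)]: when block [n] begins, [free n] binary
digits of [x] have been written, and they occupy, together with the code
blocks, the first [pos n] binary digits of the output. The number [Q] is where
the code of block [n'] would end without the fresh digits. Taking the next
[free] to be [n * Q] makes [Q] negligible, and the next [pos] is then
[free / s] up to the error [Q + 1]; for [s < 1] the surplus positions are
padded with zeros. *)
Fixpoint schedule n : nat * nat :=
  if n is n'.+1 then
    let: (M, P) := schedule n' in
    let Q := (P + n * (2 ^ M).+1)%N in
    let M' := (n * Q)%N in
    (M', (Num.truncn (M'%:R / s)).+1 + Q)%N
  else (0, 0)%N.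

Definition free n : nat := (schedule n).1.
Definition pos n : nat := (schedule n).2.
(** Fresh digits occupy the positions from [pos n] to [codepos n]. *)
Definition codepos n : nat := (pos n + (free n.+1 - free n))%N.

Lemma freeS n : free n.+1 = (n.+1 * (pos n + n.+1 * (2 ^ free n).+1))%N.
Proof. by rewrite /free /pos /=; case: (schedule n). Qed.

Lemma posS n : pos n.+1 =
  ((Num.truncn ((free n.+1)%:R / s)).+1 + (pos n + n.+1 * (2 ^ free n).+1))%N.
Proof. by rewrite /free /pos /=; case: (schedule n). Qed.

Lemma free_le_pos n : (free n)%:R <= s * (pos n)%:R.
Proof.
have /andP[s0 s1] := s01; case: n => [|n]; first by rewrite mulr0.
rewrite mulrC -ler_pdivrMr// posS natrD.
apply: le_trans (ltW (truncnS_gt _)) _; first by rewrite lerDl.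
Qed.

Lemma free_le_posN n : (free n <= pos n)%N.
Proof.
have /andP[s0 s1] := s01.
by rewrite -(ler_nat R) (le_trans (free_le_pos n))// ler_piMl.
Qed.

Lemma free_leS n : (free n <= free n.+1)%N.
Proof. by rewrite freeS; have := free_le_posN n; nia. Qed.

Lemma free_homo : {homo free : m n / (m <= n)%N}.
Proof. exact: homo_leq (leqnn) (leq_trans) free_leS. Qed.

Lemma free_ge n : (n <= free n)%N.
Proof. by case: n => // n; rewrite freeS; nia. Qed.

(** Room for the isolated 1 of every possible code and for [n.+1] zeros after
it. The fresh digits fit because [free n.+1 <= free n.+1 / s]. *)
Lemma codepos_gap n : (codepos n + n.+1 * (2 ^ free n).+1 <= pos n.+1)%N.
Proof.
have /andP[s0 s1] := s01.
suff : (free n.+1 <= (Num.truncn ((free n.+1)%:R / s)).+1)%N.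
  by rewrite posS /codepos; lia.
rewrite -(ler_nat R); apply: le_trans (ltW (truncnS_gt _)).
by rewrite ler_pdivlMr// ler_piMr.
Qed.

Lemma pos_homo : {homo pos : m n / (m <= n)%N}.
Proof.
apply: homo_leq (leqnn) (leq_trans) _ => n.
by apply: leq_trans (codepos_gap n); rewrite /codepos -addnA leq_addr.
Qed.

(** The density of written digits at the start of a block tends to [s]; the
finitely many early blocks are absorbed by [K]. *)
Lemma pos_asymptotic t : 0 <= t < s ->
  exists K : nat, forall n, t * (pos n)%:R <= (free n)%:R + K%:R.
Proof.
move=> /andP[t0 ts]; have /andP[s0 s1] := s01.
(* from block N on, t / s + t / n <= 1 *)
pose N := (Num.truncn (t / (1 - t / s))).+1.
have ts1 : 0 < 1 - t / s by rewrite subr_gt0 ltr_pdivrMr// mul1r.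
exists (pos N).+1 => n.
have t1 : t <= 1 by rewrite ltW// (lt_le_trans ts).
have [nN|Nn] := leqP n N.
  have : (pos n)%:R <= (pos N)%:R :> R by rewrite ler_nat pos_homo.
  have : t * (pos n)%:R <= (pos n)%:R by rewrite ler_piMl.
  have : 0 <= (free n)%:R :> R by exact: ler0n.
  by rewrite -natr1; lra.
case: n Nn => // n Nn.
set M := free n.+1; set Q := (pos n + n.+1 * (2 ^ free n).+1)%N.
have MQ : M%:R = n.+1%:R * Q%:R :> R by rewrite /M freeS natrM.
have tn : t <= (1 - t / s) * n.+1%:R.
  rewrite mulrC -ler_pdivrMr//; apply: le_trans (ltW (truncnS_gt _)) _.
  by rewrite ler_nat ltnW.
have Ms : (Num.truncn (M%:R / s))%:R <= M%:R / s.
  by rewrite truncn_le// divr_ge0// ltW.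
rewrite posS -/M -/Q natrD -natr1.
have tQ : t * Q%:R <= (1 - t / s) * M%:R.
  by rewrite MQ mulrA ler_wpM2r.
have tM := ler_wpM2l t0 Ms.
rewrite -natr1; have : 0 <= (pos N)%:R :> R by exact: ler0n.
have tsM : (1 - t / s) * M%:R = M%:R - t * (M%:R / s) by field; rewrite gt_eqF.
by move: tQ tM; rewrite tsM; lra.
Qed.

Definition digits n x : nat := Num.truncn (2 ^+ free n * x).

Lemma digits_itv n x : x \in `[0, 1[ ->
  (digits n x)%:R <= 2 ^+ free n * x < (digits n x).+1%:R.
Proof.
rewrite in_itv /= => /andP[x0 _]; apply: truncn_itv.
by rewrite mulr_ge0// exprn_ge0.
Qed.

Lemma digits_lt n x : x \in `[0, 1[ -> (digits n x < 2 ^ free n)%N.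
Proof.
move=> xI; have /andP[dx _] := digits_itv n _ xI; move: xI.
rewrite in_itv /= => /andP[_ x1].
rewrite -(ltr_nat R) natrX (le_lt_trans dx)// gtr_pMr// exprn_gt0//.
Qed.

Lemma digits_refine i n x : x \in `[0, 1[ -> (i <= n)%N ->
  (2 ^ (free n - free i) * digits i x <= digits n x
    < 2 ^ (free n - free i) * (digits i x).+1)%N.
Proof.
move=> xI iN; have /andP[dn dn'] := digits_itv n _ xI.
have /andP[di di'] := digits_itv i _ xI.
have E : 2 ^+ free n = 2 ^+ (free n - free i) * 2 ^+ free i :> R.
  by rewrite -exprD subnK// free_homo.
have p0 : 0 < 2 ^+ (free n - free i) :> R by rewrite exprn_gt0.
apply/andP; split.
  rewrite -ltnS -(ltr_nat R) (le_lt_trans _ dn')// natrM natrX E -mulrA.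
  by rewrite ler_pM2l.
rewrite -(ltr_nat R) (le_lt_trans dn)// natrM natrX E -mulrA.
by rewrite ltr_pM2l.
Qed.

Lemma digits_eq i n x y : x \in `[0, 1[ -> y \in `[0, 1[ -> (i <= n)%N ->
  digits n x = digits n y -> digits i x = digits i y.
Proof.
move=> xI yI iN dxy; have := digits_refine i n x xI iN.
have := digits_refine i n y yI iN; rewrite dxy.
set p := (2 ^ _)%N => /andP[h1 h2] /andP[h3 h4].
have := leq_ltn_trans h1 h4; have := leq_ltn_trans h3 h2.
have p0 : (0 < p)%N by rewrite expn_gt0.
by rewrite !ltn_pmul2l// !ltnS => ? ?; apply/eqP; rewrite eqn_leq; apply/andP.
Qed.

(** The first term writes the fresh digits of [x], as an integer on the
positions up to [codepos n]; the second is the isolated 1. *)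
Definition block n x : R :=
  ((digits n.+1 x)%:R - 2 ^+ (free n.+1 - free n) * (digits n x)%:R)
    / 2 ^+ codepos n
  + 2 ^- (codepos n + n.+1 * (digits n x).+1).

Definition prefix n x : R := \sum_(i < n) block i x.

(** The sum of the series of the blocks. *)
Definition code x : R := sup (range (prefix^~ x)).

Lemma block_ge0 n x : x \in `[0, 1[ -> 0 <= block n x.
Proof.
move=> xI; have /andP[h _] := digits_refine n n.+1 x xI (leqnSn n).
rewrite addr_ge0// ?invr_ge0 ?exprn_ge0// divr_ge0 ?exprn_ge0// subr_ge0.
by rewrite -natrX -natrM ler_nat.
Qed.

(** A block together with all that follows does not exceed one unit of the last
position before it; the bound is in the form that telescopes. *)
Lemma block_le n x : x \in `[0, 1[ ->
  block n x + 2 ^- pos n.+1 <= 2 ^- pos n.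
Proof.
move=> xI; have /andP[_ h] := digits_refine n n.+1 x xI (leqnSn n).
set m := (free n.+1 - free n)%N in h *.
have Ep : 2 ^- pos n = 2 ^+ m / 2 ^+ codepos n :> R.
  by rewrite /codepos -/m exprD invfM mulrCA divff ?mulr1// expf_neq0.
have h1 : (digits n.+1 x)%:R - 2 ^+ m * (digits n x)%:R <= 2 ^+ m - 1 :> R.
  by move: h; rewrite -(ler_nat R) mulnS natrD natrM natrX -natr1; lra.
have h2 : 2 ^- (codepos n + n.+1 * (digits n x).+1) <= 2 ^- (codepos n).+1 :> R.
  by apply: half_pow_le; lia.
have h3 : 2 ^- pos n.+1 <= 2 ^- (codepos n).+1 :> R.
  by apply: half_pow_le; have := codepos_gap n; lia.
have h4 : 2 ^- (codepos n).+1 = 2 ^- codepos n / 2 :> R by rewrite exprSr invfM.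
have e0 : 0 < 2 ^- codepos n :> R by rewrite invr_gt0 exprn_gt0.
have := ler_wpM2r (ltW e0) h1.
rewrite [leRHS]mulrBl mul1r /block -/m Ep; move: h2 h3; rewrite h4.
by lra.
Qed.

Lemma prefixS n x : prefix n.+1 x = prefix n x + block n x.
Proof. by rewrite /prefix big_ord_recr. Qed.

Lemma prefix_le m n x : x \in `[0, 1[ -> prefix m x <= prefix n x + 2 ^- pos n.
Proof.
move=> xI.
have up : {homo prefix^~ x : i j / (i <= j)%N >-> i <= j}.
  apply: (homo_leq (@lexx _ R) le_trans) => i.
  by rewrite prefixS lerDl block_ge0.
have down : {homo (fun i => prefix i x + 2 ^- pos i) : i j / (i <= j)%N >-> j <= i}.
  apply: (homo_leq (@lexx _ R) (fun _ _ _ h k => le_trans k h)) => i.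
  by rewrite prefixS -addrA lerD2l block_le.
have p0 i : 0 <= 2 ^- pos i :> R by rewrite invr_ge0 exprn_ge0.
have [mn|/ltnW nm] := leqP m n.
  by apply: (le_trans (up _ _ mn)); rewrite lerDl.
by apply: le_trans (down _ _ nm); rewrite lerDl.
Qed.

Lemma code_itv n x : x \in `[0, 1[ ->
  prefix n x <= code x <= prefix n x + 2 ^- pos n.
Proof.
move=> xI; apply/andP; split.
  apply: ub_le_sup; last by exists n.
  by exists (prefix n x + 2 ^- pos n) => _ [m _ <-]; exact: prefix_le.
apply: ge_sup; first by exists (prefix 0 x); exists 0%N.
by move=> _ [m _ <-]; exact: prefix_le.
Qed.

Lemma prefix_eq n x y : x \in `[0, 1[ -> y \in `[0, 1[ ->
  digits n x = digits n y -> prefix n x = prefix n y.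
Proof.
move=> xI yI dxy; apply: eq_bigr => i _.
have di : digits i x = digits i y by apply: (digits_eq _ n) dxy => //; exact: ltnW.
have diS : digits i.+1 x = digits i.+1 y by apply: (digits_eq _ n) dxy.
by rewrite /block di diS.
Qed.

Lemma code_piece_diameter n x y : x \in `[0, 1[ -> y \in `[0, 1[ ->
  digits n x = digits n y -> `|code x - code y| <= 2 ^- pos n.
Proof.
move=> xI yI dxy; have := code_itv n y yI; have := code_itv n x xI.
by rewrite (prefix_eq n x y)// ler_norml => /andP[? ?] /andP[? ?]; lra.
Qed.

(** The two codes have the same isolated 1 in block [n], as it records only the
earlier digits. The difference thus comes from the fresh digits, up to half a
unit of the last of them. *)
Lemma code_separated n x y : x \in `[0, 1[ -> y \in `[0, 1[ ->
  digits n x = digits n y ->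
  ((digits n.+1 x)%:R - (digits n.+1 y)%:R) / 2 ^+ codepos n - 2 ^- (codepos n).+1
    <= code x - code y.
Proof.
move=> xI yI dxy.
have /andP[hx _] := code_itv n.+1 x xI; have /andP[_ hy] := code_itv n.+1 y yI.
have h3 : 2 ^- pos n.+1 <= 2 ^- (codepos n).+1 :> R.
  by apply: half_pow_le; have := codepos_gap n; lia.
move: hx hy; rewrite !prefixS (prefix_eq n x y)// /block dxy.
by rewrite !mulrBl; lra.
Qed.

Lemma digits_neq n x y : x \in `[0, 1[ -> y \in `[0, 1[ ->
  1 <= n%:R * `|x - y| -> digits n x != digits n y.
Proof.
move=> xI yI nxy; apply/eqP => dxy.
have /andP[hx hx'] := digits_itv n x xI; have /andP[hy hy'] := digits_itv n y yI.
have : 2 ^+ free n * `|x - y| < 1.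
  rewrite -[X in X * _]gtr0_norm ?exprn_gt0// -normrM mulrBr ltr_norml.
  by move: hx hx' hy hy'; rewrite dxy -natr1; lra.
rewrite ltNge => /negP; apply; apply: (le_trans nxy).
rewrite ler_wpM2r// -natrX ler_nat; apply: leq_trans (free_ge n) _.
exact/ltnW/ltn_expl.
Qed.

(** [digits 0] is constant, as [free 0 = 0]. *)
Lemma first_differing_digits x y : x \in `[0, 1[ -> y \in `[0, 1[ -> x != y ->
  exists2 n, digits n x = digits n y & digits n.+1 x != digits n.+1 y.
Proof.
move=> xI yI xy.
have exn : exists n, digits n x != digits n y.
  exists (Num.truncn `|x - y|^-1).+1; apply: digits_neq => //.
  rewrite -ler_pdivrMr ?normr_gt0 ?subr_eq0// div1r.
  exact/ltW/truncnS_gt.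
case: (ex_minnP exn) => -[|n] dn minn.
  have := digits_lt 0 x xI; have := digits_lt 0 y yI.
  by move: dn; rewrite /free /= !ltnS !leqn0 => /eqP d /eqP h1 /eqP h2; case: d; rewrite h1 h2.
exists n => //; apply/eqP; apply: contraT => dn'.
by have := minn _ dn'; rewrite ltnn.
Qed.

(** Let [n] be the first block where [x] and [y] differ, [m] its number of fresh
digits and [D] the difference of the integers they form. Then [|x - y|] is at
most [2 D / 2 ^ (free n + m)] and [|code x - code y|] is at least
[D / 2 ^ (pos n + m + 1)]. As [D <= 2 ^ m], the quotient of the former by the
[t]-th power of the latter is largest for [D = 2 ^ m], where it is
[2 ^ (t * pos n - free n)] up to a constant. *)
Lemma code_expanding t : 0 <= t < s -> exists2 C : R, 0 < C &
  {in `[0, 1[ &, forall x y, `|x - y| <= C * `|code x - code y| `^ t}.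
Proof.
move=> ts; have /andP[t0 ts'] := ts; have /andP[s0 s1] := s01.
have [K HK] := pos_asymptotic t ts.
exists (2 `^ (K%:R + 2)); first exact: powR_gt0.
suff key x y : x \in `[0, 1[ -> y \in `[0, 1[ -> forall n,
    digits n x = digits n y -> (digits n.+1 y < digits n.+1 x)%N ->
    `|x - y| <= 2 `^ (K%:R + 2) * `|code x - code y| `^ t.
  move=> x y xI yI; have [->|xy] := eqVneq x y.
    by rewrite subrr normr0 mulr_ge0 ?powR_ge0.
  have [n dn] := first_differing_digits x y xI yI xy.
  case: ltngtP => // dn' _; last exact: (key x y xI yI n).
  by rewrite distrC (distrC (code x)); exact: (key y x yI xI n).
move=> xI yI n dn lt.
have [hx hx'] := andP (digits_itv n.+1 x xI).
have [hy hy'] := andP (digits_itv n.+1 y yI).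
have sep := code_separated n x y xI yI dn.
have [_ rx] := andP (digits_refine n n.+1 x xI (leqnSn n)).
have [ry _] := andP (digits_refine n n.+1 y yI (leqnSn n)).
move: rx ry; set m := (_ - _)%N => rx ry; rewrite dn in rx.
pose D := (digits n.+1 x - digits n.+1 y)%N.
have DE : D%:R = (digits n.+1 x)%:R - (digits n.+1 y)%:R :> R.
  by rewrite natrB// ltnW.
have D1 : 1 <= D%:R :> R by rewrite ler1n subn_gt0.
have Dm : D%:R <= 2 `^ m%:R :> R.
  by rewrite powR_mulrn// -natrX ler_nat /D; nia.
have D0 : 0 <= D%:R :> R by [].
rewrite -DE in sep.
(* the code distance is at least half a unit of the last free position *)
have lo : D%:R * 2 `^ (- (codepos n).+1%:R) <= `|code x - code y|.
  rewrite powRN powR_mulrn//; apply: le_trans (ler_norm _); apply: le_trans sep.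
  rewrite exprSr invfM; have : 0 < 2 ^- codepos n :> R by rewrite invr_gt0 exprn_gt0.
  by set u := 2 ^- _; nra.
have up : `|x - y| <= 2 * D%:R * 2 `^ (- (free n.+1)%:R).
  rewrite powRN powR_mulrn// ler_pdivlMr ?exprn_gt0// mulrC.
  rewrite -[X in X * _]gtr0_norm ?exprn_gt0// -normrM mulrBr ler_norml.
  by move: hx hx' hy hy'; rewrite DE -!natr1 in D1 *; lra.
apply: (le_trans up).
apply: (@le_trans _ _ (2 `^ (K%:R + 2) * (D%:R * 2 `^ (- (codepos n).+1%:R)) `^ t));
  last first.
  rewrite ler_pM2l ?powR_gt0//; apply: ge0_ler_powR => //.
  by rewrite nnegrE mulr_ge0// powR_ge0.
rewrite powRM ?powR_ge0// -powRrM.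
have DD : D%:R <= D%:R `^ t * 2 `^ (m%:R * (1 - t)).
  have Dt : D%:R = D%:R `^ t * D%:R `^ (1 - t) :> R.
    rewrite -powRD ?(gt_eqF (lt_le_trans ltr01 D1)) ?implybT//.
    by rewrite subrKC powRr1.
  rewrite [leLHS]Dt ler_wpM2l ?powR_ge0// powRrM.
  apply: ge0_ler_powR => //; rewrite ?nnegrE ?powR_ge0//.
  by rewrite subr_ge0 ltW// (lt_le_trans ts').
have exps : 2 `^ (m%:R * (1 - t)) * (2 * 2 `^ (- (free n.+1)%:R))
    <= 2 `^ (K%:R + 2) * 2 `^ (- (codepos n).+1%:R * t) :> R.
  have two0 r1 r2 : (r1 + r2 == 0 :> R) ==> (2 != 0 :> R).
    by rewrite pnatr_eq0 implybT.
  rewrite -{2}(powRr1 (ler0n R 2)) -!powRD// ler_powR ?ler1n//.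
  have := HK n; rewrite /codepos -/m -(natr1 (pos n + m)) natrD.
  have -> : (free n.+1)%:R = (free n)%:R + m%:R :> R.
    by rewrite -natrD subnKC// free_leS.
  have t1 : t <= 1 by rewrite ltW// (lt_le_trans ts').
  by lra.
have c0 : 0 <= 2 * 2 `^ (- (free n.+1)%:R) :> R by rewrite mulr_ge0// powR_ge0.
have := ler_wpM2r c0 DD; have := ler_wpM2l (powR_ge0 D%:R t) exps.
by lra.
Qed.

(** The pieces on which [digits n] is constant have total size
[2 ^ free n * (2 ^- pos n) ^ t <= 2 ^ ((s - t) * pos n)]. *)
Lemma finely_covered_code t : s < t -> finely_covered t (code @` `[0, 1[).
Proof.
move=> st e e0; have /andP[s0 s1] := s01.
have t0 : 0 < t by rewrite (lt_trans s0).
have [j je] : exists j, 2 ^- j <= e.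
  exists (Num.truncn e^-1).
  by apply: half_pow_le_of_inv => //; exact/ltW/truncnS_gt.
have [n jn jnt] : exists2 n, (j <= n)%N & j%:R <= n%:R * (t - s).
  exists (j + (Num.truncn (j%:R / (t - s))).+1)%N; first exact: leq_addr.
  rewrite -ler_pdivrMr ?subr_gt0// natrD.
  by apply: le_trans (ltW (truncnS_gt _)) _; rewrite lerDr.
have np : (n <= pos n)%N by apply: leq_trans (free_ge n) (free_le_posN n).
pose U i := code @` [set x | digits n x = i /\ x \in `[0, 1[].
have dU i y z : U i y -> U i z -> `|y - z| <= 2 ^- pos n.
  move=> [x [dx xI] <-] [x' [dx' xI'] <-].
  by apply: code_piece_diameter => //; rewrite dx dx'.
have p0 : 0 <= 2 ^- pos n :> R by rewrite invr_ge0 exprn_ge0.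
exists U; split.
- move=> i; apply: diameter_le => [|y z Uy Uz]; first exact: ltW.
  apply: le_trans (dU i y z Uy Uz) (le_trans _ je).
  by apply: half_pow_le; exact: leq_trans np.
- by move=> _ [x xI <-]; exists (digits n x) => //; exists x.
have Dge0 i : (0 <= diameter_pow t (U i))%E by exact: diameter_pow_ge0.
(* the pieces of index at least [2 ^ free n] are empty *)
rewrite (@nneseries_split _ _ 0 (2 ^ free n)) => [|k _]; last exact: Dge0.
rewrite add0n [X in (_ + X)%E]eseries0 ?adde0; last first.
  move=> i ni _; rewrite /diameter_pow ifT//; apply/eqP/seteqP; split=> // y.
  by move=> [x [dx xI] _]; move: ni; rewrite -dx leqNgt /= digits_lt.
apply: (@le_trans _ _ (\sum_(0 <= i < 2 ^ free n) ((2 ^- pos n) `^ t)%:E)%E).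
  apply: lee_sum => i _; apply: diameter_pow_le => //; [exact: ltW|exact: dU].
rewrite sumEFin lee_fin sumr_const_nat subn0 -[leLHS]mulr_natl.
rewrite natrX -powR_mulrn// -powR_invn// -powRrM -powRD; last by rewrite pnatr_eq0 implybT.
apply: le_trans je; rewrite -powR_invn//; apply: ler_powR; first by rewrite ler1n.
have := free_le_pos n; have : n%:R <= (pos n)%:R :> R by rewrite ler_nat.
rewrite mulNr => npR Mp.
have : n%:R * (t - s) <= (pos n)%:R * (t - s) by rewrite ler_wpM2r// subr_ge0 ltW.
lra.
Qed.

Lemma hausdorff_measure_code t (A : set R) : 0 <= t < s ->
  code @` `[0, 1[ `<=` A -> hausdorff_measure t A != 0%E.
Proof.
move=> ts codeA; have [C C0 expC] := code_expanding t ts.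
apply: (hausdorff_measure_expanding t code C A) => //.
  by case/andP: ts.
by move=> x xI; apply: codeA; exists x.
Qed.

Lemma prefix_int n x : x \in `[0, 1[ -> prefix n x * 2 ^+ pos n \is a Num.int.
Proof.
move=> xI; elim: n => [|n IH]; first by rewrite /prefix big_ord0 mul0r rpred0.
have gap := codepos_gap n; have dlt := digits_lt n x xI.
set P := pos n.+1 in gap *.
have posE : (pos n <= codepos n)%N by rewrite /codepos leq_addr.
rewrite prefixS mulrDl rpredD//.
  have -> : 2 ^+ P = 2 ^+ pos n * 2 ^+ (P - pos n) :> R.
    by rewrite -exprD subnKC//; lia.
  by rewrite mulrA rpredM// int_pow2.
rewrite /block mulrDl rpredD//.
  rewrite -mulrA [_^-1 * _]mulrC pow2_div_int; last by lia.
  by rewrite rpredM// ?int_pow2// rpredB ?rpredM ?rpred_nat ?int_pow2.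
by rewrite mulrC pow2_div_int ?int_pow2//; nia.
Qed.

(** Multiplication by this power of two makes the fresh digits integral, and
pushes everything after the code block below [2 ^- (n.+1).*2]; only the
isolated 1 of block [n] has a position that depends on [digits n x]. *)
Lemma code_shift n k x : x \in `[0, 1[ -> (k < 2 ^ free n)%N ->
  exists z r, [/\ z \is a Num.int, 0 <= r <= 2 ^- (n.+1).*2 &
    2 ^+ (codepos n + n.+1 * k) * code x =
      z + 2 ^+ (n.+1 * k) * 2 ^- (n.+1 * (digits n x).+1) + r].
Proof.
move=> xI kn; have two0 : (2 : R) != 0 by rewrite pnatr_eq0.
have /andP[lo hi] := code_itv n.+1 x xI.
set W := 2 ^+ (codepos n + n.+1 * k).
have W0 : 0 < W by rewrite exprn_gt0.
exists (W * (prefix n x + ((digits n.+1 x)%:R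
  - 2 ^+ (free n.+1 - free n) * (digits n x)%:R) / 2 ^+ codepos n)),
  (W * (code x - prefix n.+1 x)); split.
- have Wpos : W = 2 ^+ pos n * 2 ^+ (free n.+1 - free n + n.+1 * k).
    by rewrite /W /codepos -exprD addnA.
  rewrite mulrDr rpredD//.
    by rewrite mulrC Wpos mulrA rpredM ?int_pow2 ?prefix_int.
  rewrite mulrCA /W pow2_div_int ?leq_addr//.
  by rewrite rpredM ?int_pow2// rpredB ?rpredM ?rpred_nat ?int_pow2.
- rewrite mulr_ge0 ?subr_ge0 ?(ltW W0)//=.
  apply: (@le_trans _ _ (W * 2 ^- pos n.+1)).
    by rewrite ler_pM2l// lerBlDl.
  by apply: pow2_div_le; have := codepos_gap n; nia.
- rewrite prefixS /block exprD invfM /W exprD.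
  by field; rewrite !expf_neq0.
Qed.

(** An isolated 1 before that of [x0] becomes an integer; one after it lies at
least [n.+1] positions further. *)
Lemma code_shift_other n x0 x : x0 \in `[0, 1[ -> x \in `[0, 1[ ->
  digits n x != digits n x0 -> exists z r, [/\ z \is a Num.int,
    `|r| <= 2 * (2 ^- n.+1) ^+ 2 &
    2 ^+ (codepos n + n.+1 * digits n x0) * code x = z + r].
Proof.
move=> x0I xI dx.
have [z [r [zint /andP[r0 r1] ->]]] := code_shift n _ x xI (digits_lt n x0 x0I).
have -> : (2 ^- n.+1) ^+ 2 = 2 ^- (n.+1).*2 :> R by rewrite -exprVn -exprM muln2 exprVn.
move: dx; rewrite neq_ltn => /orP[lt|gt].
- exists (z + 2 ^+ (n.+1 * digits n x0) * 2 ^- (n.+1 * (digits n x).+1)), r; split => //.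
  + by rewrite rpredD// pow2_div_int ?int_pow2// leq_mul2l lt orbT.
  + by rewrite ger0_norm//; move: r0 r1; lra.
- exists z, (2 ^+ (n.+1 * digits n x0) * 2 ^- (n.+1 * (digits n x).+1) + r); split => //.
  + have h : 2 ^+ (n.+1 * digits n x0) * 2 ^- (n.+1 * (digits n x).+1) <= 2 ^- (n.+1).*2 :> R.
      by apply: pow2_div_le; nia.
    have h0 : 0 <= 2 ^+ (n.+1 * digits n x0) * 2 ^- (n.+1 * (digits n x).+1) :> R.
      by rewrite mulr_ge0// ?invr_ge0 exprn_ge0.
    by rewrite ger0_norm ?addr_ge0//; move: r1 h; lra.
  + by rewrite addrA.
Qed.

Lemma code_shift_self n x : x \in `[0, 1[ -> exists z r, [/\ z \is a Num.int,
    `|r| <= 2 * (2 ^- n.+1) ^+ 2 &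
    2 ^+ (codepos n + n.+1 * digits n x) * code x = z + 2 ^- n.+1 + r].
Proof.
move=> xI.
have [z [r [zint /andP[r0 r1] ->]]] := code_shift n _ x xI (digits_lt n x xI).
have -> : (2 ^- n.+1) ^+ 2 = 2 ^- (n.+1).*2 :> R by rewrite -exprVn -exprM muln2 exprVn.
exists z, r; split => //; first by rewrite ger0_norm//; move: r0 r1; lra.
by rewrite mulnSr exprD invfM mulrA mulfV ?mul1r// expf_neq0// pnatr_eq0.
Qed.

Lemma common_denominator (h : seq R) (c : R -> rat) :
  exists2 N : int, 0 < N & forall y, y \in h -> ratr (c y) * N%:~R \is a @Num.int R.
Proof.
elim: h => [|y h [N N0 IH]]; first by exists 1.
exists (N * denq (c y)); first by rewrite mulr_gt0// denq_gt0.
move=> z; rewrite inE intrM => /orP[/eqP ->|zh]; last first.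
  by rewrite mulrA rpredM ?IH// intr_int.
rewrite mulrCA /ratr divfK ?intr_eq0 ?denq_neq0//.
by rewrite rpredM// intr_int.
Qed.

(** With [b] the coefficients multiplied by a common denominator and [W] the
power of two that singles out [x0 = u y0], the relation becomes
[Z + b y0 * ep + D = 0] with [Z] an integer and [|D| <= ep / 2]. As
[ep <= |b y0 * ep| <= 1 / 4], first [Z = 0], and then [b y0 * ep = - D] is too
large. *)
Lemma Qlinear_independent_code : Qlinear_independent (code @` `[0, 1[).
Proof.
move=> h c uh hB sum0 y0 y0h; apply/eqP; apply: contraT => cy0.
have two0 : (2 : R) != 0 by rewrite pnatr_eq0.
have preim y : exists x, y \in h -> code x = y /\ x \in `[0, 1[.
  have [/hB[x xI xy]|] := pselect (y \in h); first by exists x.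
  by exists 0.
pose u y := projT1 (cid (preim y)).
have uI y : y \in h -> u y \in `[0, 1[ by move=> yh; rewrite /u; case: cid => x /= /(_ yh)[].
have uK y : y \in h -> code (u y) = y by move=> yh; rewrite /u; case: cid => x /= /(_ yh)[].
have [N' N'0 Nint] := common_denominator h c; pose N : R := N'%:~R.
have N0 : 0 < N by rewrite ltr0z.
pose b y : R := ratr (c y) * N.
pose C := \sum_(y <- h) `|b y|.
pose K := \sum_(y <- h) `|u y - u y0|^-1.
have K0 : 0 <= K by apply: sumr_ge0.
have C0 : 0 <= C by apply: sumr_ge0.
(* K makes the digits of the finitely many preimages distinct at level n;
   4 * C bounds the coefficients by 1 / (4 * ep) *)
pose n := (Num.truncn (K + 4 * C)).+1.
have nK : K + 4 * C < n%:R by exact: truncnS_gt.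
have sep y : y \in h -> y != y0 -> digits n (u y) != digits n (u y0).
  move=> yh yy0; apply: digits_neq; [exact: uI|exact: uI|].
  have uy : 0 < `|u y - u y0|.
    rewrite normr_gt0 subr_eq0; apply: contra_neq yy0 => uyy.
    by rewrite -(uK y yh) -(uK y0 y0h) uyy.
  rewrite -ler_pdivrMr// div1r; apply: le_trans (ltW nK).
  rewrite -[leLHS]addr0 lerD ?mulr_ge0//.
  rewrite /K (big_rem y)//= lerDl; exact: sumr_ge0.
pose ep : R := 2 ^- n.+1.
have ep0 : 0 < ep by rewrite invr_gt0 exprn_gt0.
have Cep : C * ep <= 4^-1.
  rewrite ler_pdivrMr ?exprn_gt0// ler_pdivlMl//.
  apply: (@le_trans _ _ n%:R); first by rewrite (le_trans _ (ltW nK))// lerDr.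
  by rewrite -natrX ler_nat; apply/ltnW/(ltn_trans (ltnSn n))/ltn_expl.
pose W : R := 2 ^+ (codepos n + n.+1 * digits n (u y0)).
have shift y : exists zr : R * R, y \in h -> [/\ zr.1 \is a Num.int,
    `|zr.2| <= 2 * ep ^+ 2 & W * y = zr.1 + (if y == y0 then ep else 0) + zr.2].
  have [yh|] := pselect (y \in h); last by exists (0, 0).
  have [->|yy0] := eqVneq y y0.
    have [z [r [? ? E]]] := code_shift_self n (u y0) (uI _ y0h).
    by exists (z, r); split => //=; rewrite -E uK.
  have [z [r [? ? E]]] := code_shift_other n (u y0) (u y) (uI _ y0h) (uI _ yh) (sep y yh yy0).
  by exists (z, r); split => //=; rewrite addr0 -E uK.
pose zr y := projT1 (cid (shift y)).
have zrP y : y \in h -> [/\ (zr y).1 \is a Num.int, `|(zr y).2| <= 2 * ep ^+ 2 &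
    W * y = (zr y).1 + (if y == y0 then ep else 0) + (zr y).2].
  by rewrite /zr; case: cid.
pose Z := \sum_(y <- h) b y * (zr y).1.
pose D := \sum_(y <- h) b y * (zr y).2.
have total : Z + b y0 * ep + D = 0.
  transitivity (\sum_(y <- h) (b y * (zr y).1 + (if y == y0 then b y * ep else 0)
     + b y * (zr y).2)).
    rewrite !big_split /= -/Z -/D; congr (_ + _ + _).
    rewrite (big_rem y0)//= eqxx big1_seq ?addr0// => y /=.
    by rewrite mem_rem_uniq// inE => /andP[/negbTE ->].
  transitivity (\sum_(y <- h) (W * N) * (ratr (c y) * y)); last first.
    by rewrite -mulr_sumr sum0 mulr0.
  rewrite !big_seq; apply: eq_bigr => y yh.
  have [_ _ E] := zrP y yh.
  transitivity (b y * (W * y)); last by rewrite /b; ring.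
  by rewrite E; case: ifP => _; ring.
have Zint : Z \is a Num.int.
  rewrite /Z big_seq; apply: rpred_sum => y yh.
  by rewrite rpredM ?Nint//; case: (zrP y yh).
have Dle : `|D| <= 2^-1 * ep.
  apply: le_trans (ler_norm_sum _ _ _) _.
  apply: (@le_trans _ _ (\sum_(y <- h) `|b y| * (2 * ep ^+ 2))).
    rewrite !big_seq; apply: ler_sum => y yh; rewrite normrM ler_wpM2l//.
    by case: (zrP y yh).
  rewrite -mulr_suml -/C; have := ler_wpM2r (ltW ep0) Cep; lra.
have b1 : 1 <= `|b y0|.
  by rewrite norm_intr_ge1 ?Nint// /b mulf_neq0 ?(gt_eqF N0)// fmorph_eq0.
have bC : `|b y0| <= C.
  by rewrite /C (big_rem y0)//= lerDl; exact: sumr_ge0.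
have bep : ep <= `|b y0 * ep| <= 4^-1.
  rewrite normrM (gtr0_norm ep0) ler_peMl ?(ltW ep0)//=.
  by apply: le_trans Cep; rewrite ler_pM2r.
have ep1 : ep <= 4^-1 by case/andP: bep => /le_trans; exact.
have Z1 : `|Z| < 1.
  have -> : Z = - (b y0 * ep + D) by move/eqP: total; rewrite -addrA addr_eq0 => /eqP.
  rewrite normrN (le_lt_trans (ler_normD _ _))//.
  by case/andP: bep; move: Dle; lra.
have Z0 : Z = 0.
  apply/eqP; apply: contraLR Z1 => Z0.
  by rewrite -leNgt norm_intr_ge1.
move: total; rewrite Z0 add0r => /eqP; rewrite addr_eq0 => /eqP bD.
by case/andP: bep; rewrite bD normrN; move: Dle ep0; lra.
Qed.

End Encoding.

(** * Hamel bases of every dimension *)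

(** For [s = 0] the empty set serves. The lower bound is stated for supersets
because it is applied to the Hamel basis. *)
Lemma independent_set_of_dim {R : realType} (s : R) : 0 <= s <= 1 ->
  exists B : set R, [/\ Qlinear_independent B,
    forall t, s < t -> finely_covered t B &
    forall t A, 0 <= t < s -> B `<=` A -> hausdorff_measure t A != 0%E].
Proof.
move=> /andP[s0 s1]; move: s0; rewrite le_eqVlt => /orP[/eqP <-|s0].
  exists set0; split.
  - move=> h c _ h0 _ x xh; by have := h0 x xh.
  - move=> t t0 e e0; exists (fun=> set0); split=> //.
    + by move=> i; apply: diameter_le => //; exact: ltW.
    + rewrite eseries0 ?lee_fin ?ltW// => i _ _.
      by rewrite /diameter_pow eqxx.
  - by move=> t A /andP[/le_lt_trans h /h]; rewrite ltxx.
have s01 : 0 < s <= 1 by rewrite s0.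
exists (code s @` `[0, 1[); split.
- exact: Qlinear_independent_code.
- by move=> t; exact: finely_covered_code.
- by move=> t A; exact: hausdorff_measure_code.
Qed.

Theorem theorem7p2 (R : realType) (s : R) (hs : 0 <= s <= 1) :
  exists H : set R, hamel_basis H /\ hausdorff_dim H = s%:E.
Proof.
have [B [indB coverB measB]] := independent_set_of_dim s hs.
have [H [hamelH BH HS]] :=
  hamel_extension B (\bigcap_k rational_nbhd k) indB null_dense_Gdelta_sum.
exists H; split => //; have /andP[s0 s1] := hs.
apply/eqP; rewrite eq_le; apply/andP; split.
- apply/lee_addgt0Pr => e e0; apply: ereal_inf_lbound.
  exists (s + e); last by rewrite EFinD.
  split; first by rewrite addr_ge0// ltW.
  apply/finely_covered_null/(finely_covered_sub _ _ _ HS).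
  apply: finely_covered_setU; first by apply: coverB; rewrite ltrDl.
  by apply: finely_covered_null_Gdelta; rewrite (le_lt_trans s0)// ltrDl.
- apply: le_ereal_inf_tmp => _ [t [t0 Ht0] <-]; rewrite lee_fin leNgt.
  apply/negP => ts; have := measB t H _ BH.
  by rewrite t0 ts Ht0 eqxx => /(_ isT).
Qed.
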